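(* The category $\mathcal{PMV}_f$ of $PMV_f$-algebras is coextensive.
   Context: An MV-algebra is $(A,\oplus,\neg,0)$ with $(A,\oplus,0)$ a commutative monoid, $\neg\neg x=x$, $x\oplus\neg 0=\neg 0$, $\neg(\neg x\oplus y)\oplus y=\neg(\neg y\oplus x)\oplus x$. Put $x\ominus y=\neg(\neg x\oplus y)$; the lattice order is $x\le y\iff x\ominus y=0$. A $PMV_f$-algebra is an MV-algebra with an associative commutative product $\cdot$ such that for all $a,b,c$: $a0=0$; $a(b\oplus c)\le ab\oplus ac$; $ab\le a\wedge b$; $a(b\ominus c)=ab\ominus ac$. Morphisms of $\mathcal{PMV}_f$ are maps preserving $\oplus,\neg,0$ and the product. The terminal object is the one-element algebra $\{0\}$. A category $\mathcal C$ is coextensive if $\mathcal C^{op}$ is extensive. Explicitly, a category with finite products is coextensive if (1) for all objects $A,B$ the pushout of the two product projections $\pi_A:A\times B\to A$ and $\pi_B:A\times B\to B$ is the terminal object, and (2) for every morphism $g:A\times B\to C$ the pushout $C\to C_1$ of $\pi_A$ along $g$ and the pushout $C\to C_2$ of $\pi_B$ along $g$ exist, and $C\cong C_1\times C_2$ via the induced morphism. *)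

(* Defs.v *)
From mathcomp Require Import ssreflect ssrfun ssrbool.
From mathcomp Require Import boolp.

Set Implicit Arguments.
Unset Strict Implicit.
Unset Printing Implicit Defensive.

Declare Scope cat_scope.
Delimit Scope cat_scope with cat.

Record category := Category {
  obj :> Type;
  hom : obj -> obj -> Type;
  idm : forall A, hom A A;
  hcomp : forall A B C, hom B C -> hom A B -> hom A C;
  hcomp_idl : forall A B (f : hom A B), hcomp (idm B) f = f;
  hcomp_idr : forall A B (f : hom A B), hcomp f (idm A) = f;
  hcomp_assoc : forall A B C D (h : hom C D) (g : hom B C) (f : hom A B),
    hcomp h (hcomp g f) = hcomp (hcomp h g) f }.

Arguments hom {c}.
Arguments idm {c}.
Arguments hcomp {c A B C}.

Notation "g \o f" := (hcomp g f) : cat_scope.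
Local Open Scope cat_scope.

Definition is_iso (K : category) (A B : K) (f : hom A B) : Prop :=
  exists g : hom B A, g \o f = idm A /\ f \o g = idm B.

Definition is_terminal (K : category) (T : K) : Prop :=
  forall X : K, exists! _ : hom X T, True.

Definition is_product (K : category) (A B P : K)
    (p : hom P A) (q : hom P B) : Prop :=
  forall (X : K) (a : hom X A) (b : hom X B),
    exists! h : hom X P, p \o h = a /\ q \o h = b.

(* The square   P --g--> C
                |        |
                f        v
                |        |
                A --u--> D   is a pushout; v is the pushout of f along g. *)
Definition is_pushout (K : category) (P A C D : K)
    (f : hom P A) (g : hom P C) (u : hom A D) (v : hom C D) : Prop :=
  u \o f = v \o g /\
  forall (X : K) (a : hom A X) (c : hom C X), a \o f = c \o g ->
    exists! h : hom D X, h \o u = a /\ h \o v = c.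

Definition has_finite_products (K : category) : Prop :=
  (exists T : K, is_terminal T) /\
  forall A B : K, exists (P : K) (p : hom P A) (q : hom P B), is_product p q.

(* Products and pushouts are only determined up to isomorphism, so the
   conditions are imposed on every choice of them. *)
Definition coextensive (K : category) : Prop :=
  has_finite_products K /\
  forall (A B P : K) (pA : hom P A) (pB : hom P B), is_product pA pB ->
    (exists (T : K) (uA : hom A T) (uB : hom B T),
        is_pushout pA pB uA uB /\ is_terminal T) /\
    forall (C : K) (g : hom P C),
      (exists (C1 : K) (u1 : hom A C1) (c1 : hom C C1),
          is_pushout pA g u1 c1) /\
      (exists (C2 : K) (u2 : hom B C2) (c2 : hom C C2),
          is_pushout pB g u2 c2) /\
      forall (C1 C2 : K) (u1 : hom A C1) (c1 : hom C C1)
             (u2 : hom B C2) (c2 : hom C C2),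
        is_pushout pA g u1 c1 -> is_pushout pB g u2 c2 ->
        forall (Q : K) (q1 : hom Q C1) (q2 : hom Q C2), is_product q1 q2 ->
        forall h : hom C Q, q1 \o h = c1 -> q2 \o h = c2 -> is_iso h.

Declare Scope mv_scope.
Delimit Scope mv_scope with mv.
Local Open Scope mv_scope.

Reserved Notation "x ⊕ y" (at level 50, left associativity).
Reserved Notation "x ⊖ y" (at level 50, left associativity).
Reserved Notation "x ⊑ y" (at level 70, no associativity).
Reserved Notation "x ⊓ y" (at level 45, left associativity).
Reserved Notation "x ⋅ y" (at level 40, left associativity).
Reserved Notation "¬ x" (at level 35, right associativity).

Record mv_algebra := MVAlgebra {
  mv_car :> Type;
  mv_add : mv_car -> mv_car -> mv_car;
  mv_neg : mv_car -> mv_car;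
  mv_zero : mv_car;
  mv_addA : associative mv_add;
  mv_addC : commutative mv_add;
  mv_add0 : right_id mv_zero mv_add;
  mv_negK : involutive mv_neg;
  mv_addN0 : forall x, mv_add x (mv_neg mv_zero) = mv_neg mv_zero;
  mv_luk : forall x y, mv_add (mv_neg (mv_add (mv_neg x) y)) y
                     = mv_add (mv_neg (mv_add (mv_neg y) x)) x }.

Arguments mv_zero {m}.
Notation "x ⊕ y" := (mv_add x y) : mv_scope.
Notation "¬ x" := (mv_neg x) : mv_scope.

Definition mv_sub (A : mv_algebra) (x y : A) : A := ¬ (¬ x ⊕ y).
Notation "x ⊖ y" := (mv_sub x y) : mv_scope.

Definition mv_le (A : mv_algebra) (x y : A) : Prop := x ⊖ y = mv_zero.
Notation "x ⊑ y" := (mv_le x y) : mv_scope.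

(* The infimum for the order above, see [mv_meetP]. *)
Definition mv_meet (A : mv_algebra) (x y : A) : A := x ⊖ (x ⊖ y).
Notation "x ⊓ y" := (mv_meet x y) : mv_scope.

Section MVTheory.
Variable A : mv_algebra.
Implicit Types x y z a b c : A.

Lemma mv_addNx x : x ⊕ ¬ x = ¬ mv_zero.
Proof.
have := mv_luk x (¬ mv_zero).
by rewrite mv_addN0 mv_negK (mv_addC mv_zero) mv_add0 mv_addC => ->; rewrite mv_addC.
Qed.

Lemma mv_leE x y : (x ⊑ y) <-> (¬ x ⊕ y = ¬ mv_zero).
Proof.
rewrite /mv_le /mv_sub; split => [ <- | -> ]; by rewrite mv_negK.
Qed.

Lemma mv_le_addr x y : x ⊑ x ⊕ y.
Proof.
by apply/mv_leE; rewrite mv_addA (mv_addC (¬ x)) mv_addNx mv_addC mv_addN0.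
Qed.

Lemma mv_subK x y : x ⊑ y -> y = x ⊕ (y ⊖ x).
Proof.
move=> xy; have := mv_luk x y.
rewrite -[¬ (_ ⊕ y)]/(x ⊖ y) xy mv_addC mv_add0 => h.
by rewrite [LHS]h mv_addC.
Qed.

Lemma mv_sub_anti a x y : x ⊑ y -> a ⊖ y ⊑ a ⊖ x.
Proof.
move=> xy; apply/mv_leE; rewrite /mv_sub mv_negK (mv_subK xy).
rewrite mv_addA -mv_addA (mv_addC (y ⊖ x)) mv_addA mv_addNx.
by rewrite mv_addC mv_addN0.
Qed.

Lemma mv_meetC x y : x ⊓ y = y ⊓ x.
Proof.
rewrite /mv_meet /mv_sub; congr (¬ _).
have := mv_luk (¬ y) (¬ x); rewrite !mv_negK => h.
by rewrite mv_addC (mv_addC _ y) h (mv_addC x) mv_addC.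
Qed.

Lemma mv_meet_lel x y : x ⊓ y ⊑ x.
Proof.
apply/mv_leE; rewrite /mv_meet {1}/mv_sub mv_negK mv_addC mv_addA mv_addNx.
by rewrite mv_addC mv_addN0.
Qed.

Lemma mv_meetP c a b : (c ⊑ a ⊓ b) <-> (c ⊑ a /\ c ⊑ b).
Proof.
have tr x y z : x ⊑ y -> y ⊑ z -> x ⊑ z.
  move=> xy yz; rewrite (mv_subK yz) (mv_subK xy) -mv_addA; exact: mv_le_addr.
split=> [h|[ca cb]].
  split; apply: tr h _; first exact: mv_meet_lel.
  by rewrite mv_meetC; apply: mv_meet_lel.
have -> : c = a ⊓ c.
  by rewrite mv_meetC /mv_meet ca /mv_sub mv_add0 mv_negK.
exact/mv_sub_anti/mv_sub_anti.
Qed.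

End MVTheory.

Record pmvf_algebra := PMVfAlgebra {
  pmvf_mv :> mv_algebra;
  pmvf_mul : pmvf_mv -> pmvf_mv -> pmvf_mv;
  pmvf_mulA : associative pmvf_mul;
  pmvf_mulC : commutative pmvf_mul;
  pmvf_mul0 : forall a, pmvf_mul a mv_zero = mv_zero;
  pmvf_mulD : forall a b c, pmvf_mul a (b ⊕ c) ⊑ pmvf_mul a b ⊕ pmvf_mul a c;
  pmvf_mul_meet : forall a b, pmvf_mul a b ⊑ a ⊓ b;
  pmvf_mulB : forall a b c, pmvf_mul a (b ⊖ c) = pmvf_mul a b ⊖ pmvf_mul a c }.

Notation "x ⋅ y" := (pmvf_mul x y) : mv_scope.

Definition is_pmvf_morphism (A B : pmvf_algebra) (f : A -> B) : Prop :=
  [/\ forall x y, f (x ⊕ y) = f x ⊕ f y,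
      forall x, f (¬ x) = ¬ f x,
      f mv_zero = mv_zero
    & forall x y, f (x ⋅ y) = f x ⋅ f y].

Definition pmvf_hom (A B : pmvf_algebra) : Type :=
  {f : A -> B | is_pmvf_morphism f}.

Lemma pmvf_hom_eq (A B : pmvf_algebra) (f g : pmvf_hom A B) :
  sval f =1 sval g -> f = g.
Proof.
case: f g => [f fP] [g gP] /= /funext fg; case: _ / fg in gP *.
by congr exist; apply: Prop_irrelevance.
Qed.

Lemma is_pmvf_morphism_id (A : pmvf_algebra) : is_pmvf_morphism (fun x : A => x).
Proof. by split. Qed.

Lemma is_pmvf_morphism_comp (A B C : pmvf_algebra) (g : B -> C) (f : A -> B) :
  is_pmvf_morphism g -> is_pmvf_morphism f ->
  is_pmvf_morphism (fun x => g (f x)).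
Proof.
move=> [gD gN g0 gM] [fD fN f0 fM]; split=> *.
- by rewrite fD gD.
- by rewrite fN gN.
- by rewrite f0 g0.
- by rewrite fM gM.
Qed.

Definition pmvf_id (A : pmvf_algebra) : pmvf_hom A A :=
  exist _ _ (is_pmvf_morphism_id A).

Definition pmvf_comp (A B C : pmvf_algebra)
    (g : pmvf_hom B C) (f : pmvf_hom A B) : pmvf_hom A C :=
  exist _ _ (is_pmvf_morphism_comp (svalP g) (svalP f)).

Definition PMVf : category.
Proof.
apply: (@Category pmvf_algebra pmvf_hom pmvf_id pmvf_comp) => *;
  exact: pmvf_hom_eq.
Defined.

(* Main.v *)
Require Import Defs.
From mathcomp Require Import ssreflect ssrfun ssrbool.
From mathcomp Require Import boolp.

Set Implicit Arguments.
Unset Strict Implicit.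
Unset Printing Implicit Defensive.

Local Open Scope mv_scope.

(** The kernel of the projection from A × B to A is the principal ideal of the
    idempotent d = (0, 1): two pairs have the same first component exactly when
    they agree after adding d. The same holds for B with ¬ d = (1, 0). So both
    projections are quotients by complementary idempotents, and coextensivity
    follows from three properties of such quotients.

    - An algebra C has a quotient by every idempotent d ([exists_quotient_by]),
      with x and y identified when x ⊕ d = y ⊕ d. As d is idempotent, the set
      {x | x ⊑ d} is an ideal and x ⊕ d is the join of x and d, so this is the
      congruence of that ideal. The product respects it because x ⋅ d ⊑ d.

    - Pushing out the quotient by d along g gives the quotient by g d
      ([pushout_of_quotient]): a morphism k out of C belongs to a cocone
      exactly when k g factors through the quotient by d, that is, when k kills
      g d. Since pushouts are unique up to isomorphism,
      every pushout is of this form ([pushout_quotient]).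

    - If d and ¬ d are both idempotent, then C maps bijectively to the product
      of its quotients by d and by ¬ d: elements equal in both differ by
      something below d and ¬ d, hence are equal ([mv_idem_inj]), and
      (x ⊖ d) ⊕ (y ⊖ ¬ d) is congruent to x modulo d and to y modulo ¬ d
      ([mv_idem_glue]).

    The pushout of the two projections themselves is then the quotient of B by
    the image 1 of d, which has one element. *)

(** * Order and idempotents in MV-algebras *)

Section Idempotents.
Variable A : mv_algebra.
Implicit Types x y z t d : A.

Lemma mv_add0x x : mv_zero ⊕ x = x.
Proof. by rewrite mv_addC mv_add0. Qed.

Lemma mv_addACA x y z t : (x ⊕ y) ⊕ (z ⊕ t) = (x ⊕ z) ⊕ (y ⊕ t).
Proof. by rewrite -!mv_addA (mv_addA y) (mv_addC y) -mv_addA. Qed.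

Lemma mv_addAC x y z : x ⊕ y ⊕ z = x ⊕ z ⊕ y.
Proof. by rewrite -!mv_addA (mv_addC y). Qed.

Lemma mv_subxx x : x ⊖ x = mv_zero.
Proof. by rewrite /mv_sub mv_addC mv_addNx mv_negK. Qed.

Lemma mv_le_trans y x z : x ⊑ y -> y ⊑ z -> x ⊑ z.
Proof.
by move=> xy yz; rewrite (mv_subK yz) (mv_subK xy) -mv_addA; apply: mv_le_addr.
Qed.

Lemma mv_le_anti x y : x ⊑ y -> y ⊑ x -> x = y.
Proof. by move=> xy yx; rewrite [RHS](mv_subK xy) yx mv_add0. Qed.

Lemma mv_le_addl x y : x ⊑ y ⊕ x.
Proof. by rewrite mv_addC; apply: mv_le_addr. Qed.

Lemma mv_le_add2r z x y : x ⊑ y -> x ⊕ z ⊑ y ⊕ z.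
Proof. by move=> /mv_subK ->; rewrite mv_addAC; apply: mv_le_addr. Qed.

Lemma mv_leBDl x y z : x ⊑ y ⊕ z -> x ⊖ y ⊑ z.
Proof. by move=> /mv_leE h; apply/mv_leE; rewrite mv_negK -mv_addA. Qed.

Lemma mv_le_sub x y : x ⊖ y ⊑ x.
Proof. exact/mv_leBDl/mv_le_addl. Qed.

Lemma mv_add_absorb d t : d ⊕ d = d -> t ⊑ d -> t ⊕ d = d.
Proof.
by move=> dd td; apply: mv_le_anti (mv_le_addl _ _); rewrite -{2}dd;
  apply: mv_le_add2r.
Qed.

(** For an idempotent [d], adding [d] is the same as joining with [d]. *)
Lemma mv_idem_join d x : d ⊕ d = d -> (x ⊖ d) ⊕ d = x ⊕ d.
Proof.
move=> dd; apply: mv_le_anti; first exact/mv_le_add2r/mv_le_sub.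
rewrite -{3}dd mv_addA; apply: mv_le_add2r.
by rewrite /mv_sub mv_luk; apply: mv_le_addl.
Qed.

Lemma mv_idem_neg d x : d ⊕ d = d -> ¬ (x ⊕ d) ⊕ d = ¬ x ⊕ d.
Proof. by move=> dd; rewrite -[RHS](mv_idem_join _ dd) /mv_sub mv_negK. Qed.

(** The difference [x ⊖ y] lies below [d] and below [¬ d], whose meet is [0]
    because [¬ d] is idempotent. *)
Lemma mv_idem_inj d x y : ¬ d ⊕ ¬ d = ¬ d ->
  x ⊕ d = y ⊕ d -> x ⊕ ¬ d = y ⊕ ¬ d -> x = y.
Proof.
move=> nd.
have meet0 t : t ⊑ d -> t ⊑ ¬ d -> t ⊑ mv_zero.
  move=> td tn; have : t ⊑ d ⊓ ¬ d by apply/mv_meetP.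
  by rewrite /mv_meet {2}/mv_sub nd mv_negK mv_subxx.
have le0 u v : u ⊕ d = v ⊕ d -> u ⊕ ¬ d = v ⊕ ¬ d -> u ⊑ v.
  move=> ud un.
  have : u ⊖ v ⊑ mv_zero.
    by apply: meet0; apply: mv_leBDl; rewrite -?ud -?un; apply: mv_le_addr.
  by rewrite /mv_le {1}/mv_sub mv_add0 mv_negK.
by move=> xd xn; apply: mv_le_anti; apply: le0.
Qed.

(** The summand [y ⊖ ¬ d] lies below [d], so it vanishes modulo [d]. *)
Lemma mv_idem_glue d x y : d ⊕ d = d ->
  (x ⊖ d) ⊕ (y ⊖ ¬ d) ⊕ d = x ⊕ d.
Proof.
move=> dd; have yd : y ⊖ ¬ d ⊑ d.
  apply: mv_leBDl; rewrite mv_addC mv_addNx.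
  by apply/mv_leE; rewrite mv_addN0.
by rewrite -mv_addA (mv_add_absorb dd yd) mv_idem_join.
Qed.

End Idempotents.

Lemma pmvf_mul_monor (A : pmvf_algebra) (a x y : A) :
  x ⊑ y -> a ⋅ x ⊑ a ⋅ y.
Proof. by move=> xy; rewrite /mv_le -pmvf_mulB xy pmvf_mul0. Qed.

(** Modulo [d] the product does not see the summand [d], because [x ⋅ d]
    lies below [d]. *)
Lemma pmvf_idem_mulr (A : pmvf_algebra) (d x y : A) :
  d ⊕ d = d -> x ⋅ (y ⊕ d) ⊕ d = x ⋅ y ⊕ d.
Proof.
move=> dd; apply: mv_le_anti; last first.
  exact/mv_le_add2r/pmvf_mul_monor/mv_le_addr.
apply: mv_le_trans (mv_le_add2r d (pmvf_mulD x y d)) _.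
have /mv_meetP [_ xd] := pmvf_mul_meet x d.
by rewrite -mv_addA (mv_add_absorb dd xd); apply: mv_subxx.
Qed.

(** * Terminal algebra, products and surjections *)

Definition unit_mv : mv_algebra.
Proof.
by apply: (@MVAlgebra unit (fun _ _ => tt) (fun _ => tt) tt) => // -[].
Defined.

Definition unit_pmvf : pmvf_algebra.
Proof. by apply: (@PMVfAlgebra unit_mv (fun _ _ => tt)). Defined.

Lemma terminal_of_subsingleton (T : pmvf_algebra) :
  (forall x y : T, x = y) -> is_terminal (K := PMVf) T.
Proof.
move=> T1 X.
have zP : is_pmvf_morphism (fun _ : X => mv_zero : T) by split=> *; apply: T1.
by exists (exist _ _ zP); split=> // h _; apply: pmvf_hom_eq => x; apply: T1.
Qed.

Section Product.
Variables A B : pmvf_algebra.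

Definition prod_mv : mv_algebra.
Proof.
apply: (@MVAlgebra (A * B) (fun x y => (x.1 ⊕ y.1, x.2 ⊕ y.2))
  (fun x => (¬ x.1, ¬ x.2)) (mv_zero, mv_zero)).
- by move=> x y z /=; rewrite !mv_addA.
- by move=> x y /=; rewrite mv_addC (mv_addC x.2).
- by case=> x y /=; rewrite !mv_add0.
- by case=> x y /=; rewrite !mv_negK.
- by move=> x /=; rewrite !mv_addN0.
- by move=> x y /=; congr pair; apply: mv_luk.
Defined.

Definition prod_pmvf : pmvf_algebra.
Proof.
apply: (@PMVfAlgebra prod_mv (fun x y => (x.1 ⋅ y.1, x.2 ⋅ y.2))).
- by move=> x y z /=; rewrite !pmvf_mulA.
- by move=> x y /=; rewrite pmvf_mulC (pmvf_mulC x.2).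
- by move=> x /=; rewrite !pmvf_mul0.
- by move=> x y z; congr pair; apply: pmvf_mulD.
- by move=> x y; congr pair; apply: pmvf_mul_meet.
- by move=> x y z; congr pair; apply: pmvf_mulB.
Defined.

Definition prod_fst : pmvf_hom prod_pmvf A.
Proof. by exists fst; split. Defined.

Definition prod_snd : pmvf_hom prod_pmvf B.
Proof. by exists snd; split. Defined.

Lemma pair_is_morphism (X : pmvf_algebra) (a : pmvf_hom X A) (b : pmvf_hom X B) :
  is_pmvf_morphism (fun x => (sval a x, sval b x) : prod_pmvf).
Proof.
case: a b => [a [aD aN a0 aM]] [b [bD bN b0 bM]].
by split=> *; congr pair.
Qed.

Definition prod_pair (X : pmvf_algebra) (a : pmvf_hom X A) (b : pmvf_hom X B) :
  pmvf_hom X prod_pmvf := exist _ _ (pair_is_morphism a b).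

End Product.

Lemma pmvf_homE (A B : pmvf_algebra) (f g : pmvf_hom A B) x :
  f = g -> sval f x = sval g x.
Proof. by move=> ->. Qed.

Lemma prod_is_product (A B : pmvf_algebra) :
  is_product (K := PMVf) (prod_fst A B) (prod_snd A B).
Proof.
move=> X a b; exists (prod_pair a b); split; first by split; apply: pmvf_hom_eq.
move=> h [<- <-]; apply: pmvf_hom_eq => x /=.
by case: (sval h x).
Qed.

(** Comparison with the algebra of pairs shows that the elements of any
    categorical product are the pairs of elements. *)
Lemma product_elements (A B P : pmvf_algebra)
    (p : pmvf_hom P A) (q : pmvf_hom P B) :
  is_product (K := PMVf) p q ->
  (forall a b, exists z, sval p z = a /\ sval q z = b) /\
  (forall y z, sval p y = sval p z -> sval q y = sval q z -> y = z).
Proof.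
move=> pq; have [m [[pm qm] _]] := pq _ (prod_fst A B) (prod_snd A B).
split=> [a b|y z yzp yzq].
  pose z : prod_pmvf A B := (a, b); exists (sval m z).
  by split; [apply: (pmvf_homE z pm) | apply: (pmvf_homE z qm)].
have [k [_ k_uniq]] := pq _ p q.
(* The pairing [n] of [p] and [q] is a section of [m], hence injective. *)
set n := prod_pair p q.
have mn x : sval m (sval n x) = x.
  have k_id : k = pmvf_id P by apply: k_uniq; split; apply: pmvf_hom_eq.
  have k_mn : k = pmvf_comp m n.
    apply: k_uniq; split; apply: pmvf_hom_eq => t.
      exact: (pmvf_homE (sval n t) pm).
    exact: (pmvf_homE (sval n t) qm).
  by rewrite -[RHS]/(sval (pmvf_id P) x) -k_id k_mn.
by rewrite -(mn y) -(mn z) /n /= yzp yzq.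
Qed.

Lemma product_swap (A B P : pmvf_algebra)
    (p : pmvf_hom P A) (q : pmvf_hom P B) :
  is_product (K := PMVf) p q -> is_product (K := PMVf) q p.
Proof.
move=> pq X b a; have [h [[ha hb] h_uniq]] := pq X a b.
by exists h; split=> // k [kb ka]; apply: h_uniq.
Qed.

(** A morphism constant on the fibres of a surjection [q] factors through [q];
    the factorization inherits the operations since [q] is onto. *)
Lemma factor_through_surjection (C Q X : pmvf_algebra)
    (q : pmvf_hom C Q) (k : pmvf_hom C X) :
  (forall z, exists x, sval q x = z) ->
  (forall x y, sval q x = sval q y -> sval k x = sval k y) ->
  exists h : pmvf_hom Q X, forall x, sval h (sval q x) = sval k x.
Proof.
move=> q_surj qk; have [s qs] := choice q_surj.
have kE x y : sval q x = y -> sval k (s y) = sval k x.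
  by move=> <-; apply: qk; rewrite qs.
suff hP : is_pmvf_morphism (fun z => sval k (s z)).
  by exists (exist _ _ hP) => x; apply: kE.
case: (svalP q) (svalP k) => [qD qN q0 qM] [kD kN k0 kM].
split=> [x y|x||x y].
- by rewrite (kE (s x ⊕ s y)) // qD !qs.
- by rewrite (kE (¬ s x)) // qN !qs.
- by rewrite (kE mv_zero).
- by rewrite (kE (s x ⋅ s y)) // qM !qs.
Qed.

Lemma bijective_is_iso (A B : pmvf_algebra) (h : pmvf_hom A B) :
  (forall z, exists x, sval h x = z) -> injective (sval h) ->
  is_iso (K := PMVf) h.
Proof.
move=> h_surj h_inj.
have [g gh] := factor_through_surjection (k := pmvf_id A) h_surj h_inj.
exists g; split; apply: pmvf_hom_eq => // z.
by have [x <-] := h_surj z; rewrite /= gh.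
Qed.

(** * Quotients by idempotents *)

(** [q] presents its codomain as the quotient of [C] by the ideal generated by
    [d]. The kernel is described correctly only for idempotent [d], where the
    ideal is [{x | x ⊑ d}]. *)
Definition quotient_by (C Q : pmvf_algebra) (d : C) (q : pmvf_hom C Q) : Prop :=
  (forall z, exists x, sval q x = z) /\
  (forall x y, sval q x = sval q y <-> x ⊕ d = y ⊕ d).

Section Quotient.
Variables (C : pmvf_algebra) (d : C) (dd : d ⊕ d = d).

(** The elements fixed by adding [d] are the largest ones in their classes. *)
Let quo := {x : C | x ⊕ d = x}.

Let cls_subproof (x : C) : (x ⊕ d) ⊕ d = x ⊕ d.
Proof. by rewrite -mv_addA dd. Qed.

Let cls (x : C) : quo := exist _ (x ⊕ d) (cls_subproof x).

Let clsP (x y : C) : cls x = cls y <-> x ⊕ d = y ⊕ d.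
Proof.
split=> [/(congr1 sval) //|xy].
exact: eq_exist.
Qed.

Let cls_eq (x y : C) : x ⊕ d = y ⊕ d -> cls x = cls y.
Proof. by move/clsP. Qed.

Let qadd (x y : quo) := cls (sval x ⊕ sval y).
Let qneg (x : quo) := cls (¬ sval x).
Let qmul (x y : quo) := cls (sval x ⋅ sval y).

Let clsD x y : qadd (cls x) (cls y) = cls (x ⊕ y).
Proof. by apply: cls_eq; rewrite /= mv_addACA dd -mv_addA dd. Qed.

Let clsN x : qneg (cls x) = cls (¬ x).
Proof. by apply: cls_eq; rewrite /= mv_idem_neg. Qed.

Let clsM x y : qmul (cls x) (cls y) = cls (x ⋅ y).
Proof.
by apply: cls_eq; rewrite /= pmvf_idem_mulr // pmvf_mulC pmvf_idem_mulr //
  pmvf_mulC.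
Qed.

Let clsW (P : quo -> Prop) : (forall x, P (cls x)) -> forall z, P z.
Proof.
move=> Pcls [x xd]; suff <- : cls x = exist _ x xd by [].
exact: eq_exist.
Qed.

Let quo_mv : mv_algebra.
Proof.
apply: (@MVAlgebra quo qadd qneg (cls mv_zero)).
- by do 3![elim/clsW=> ?]; rewrite !clsD mv_addA.
- by do 2![elim/clsW=> ?]; rewrite !clsD mv_addC.
- by elim/clsW=> ?; rewrite clsD mv_add0.
- by elim/clsW=> ?; rewrite !clsN mv_negK.
- by elim/clsW=> ?; rewrite !clsN clsD mv_addN0.
- by do 2![elim/clsW=> ?]; rewrite !(clsN, clsD) mv_luk.
Defined.

Let clsB (x y : C) : (cls x : quo_mv) ⊖ cls y = cls (x ⊖ y).
Proof. by rewrite /mv_sub /= !(clsN, clsD). Qed.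

Let cls_le (x y : C) : x ⊑ y -> (cls x : quo_mv) ⊑ cls y.
Proof. by move=> xy; rewrite /mv_le clsB xy. Qed.

Let quo_pmvf : pmvf_algebra.
Proof.
apply: (@PMVfAlgebra quo_mv qmul).
- by do 3![elim/clsW=> ?]; rewrite !clsM pmvf_mulA.
- by do 2![elim/clsW=> ?]; rewrite !clsM pmvf_mulC.
- by elim/clsW=> ?; rewrite clsM pmvf_mul0.
- by do 3![elim/clsW=> ?]; rewrite /= !(clsM, clsD); apply/cls_le/pmvf_mulD.
- do 2![elim/clsW=> ?]; rewrite /mv_meet !(clsM, clsB).
  exact/cls_le/pmvf_mul_meet.
- by do 3![elim/clsW=> ?]; rewrite !(clsM, clsB) pmvf_mulB.
Defined.

Lemma exists_quotient_by :
  exists (Q : pmvf_algebra) (q : pmvf_hom C Q), quotient_by d q.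
Proof.
have clsH : is_pmvf_morphism (cls : C -> quo_pmvf).
  by split=> *; rewrite /= ?clsD ?clsN ?clsM.
exists quo_pmvf, (exist _ _ clsH); split; last exact: clsP.
by elim/clsW=> x; exists x.
Qed.

End Quotient.

(** The quotient by [d] is universal among the morphisms that kill [d]. *)
Lemma quotient_by_factor (C Q X : pmvf_algebra) (d : C)
    (q : pmvf_hom C Q) (k : pmvf_hom C X) :
  quotient_by d q -> sval k d = mv_zero ->
  exists h : pmvf_hom Q X, forall x, sval h (sval q x) = sval k x.
Proof.
move=> [q_surj qE] kd; apply: factor_through_surjection => // x y /qE.
by move/(congr1 (sval k)); have [kD _ _ _] := svalP k; rewrite !kD kd !mv_add0.
Qed.

Lemma quotient_by_kill (C Q : pmvf_algebra) (d : C) (q : pmvf_hom C Q) :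
  d ⊕ d = d -> quotient_by d q -> sval q d = mv_zero.
Proof.
move=> dd [_ qE]; have [_ _ <- _] := svalP q.
by apply/qE; rewrite dd mv_add0x.
Qed.

Lemma hom_idem (A B : pmvf_algebra) (f : pmvf_hom A B) d :
  d ⊕ d = d -> sval f d ⊕ sval f d = sval f d.
Proof. by move=> dd; have [<- _ _ _] := svalP f; rewrite dd. Qed.

(** The projection to [A] is the quotient by [d = (0, 1)], because adding [d]
    replaces the second component by [1] and leaves the first one alone. *)
Lemma projection_quotient (A B P : pmvf_algebra)
    (p : pmvf_hom P A) (q : pmvf_hom P B) (d : P) :
  is_product (K := PMVf) p q ->
  sval p d = mv_zero -> sval q d = ¬ mv_zero ->
  d ⊕ d = d /\ quotient_by d p.
Proof.
move=> /product_elements [ex inj] pd qd.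
have [pD _ _ _] := svalP p; have [qD _ _ _] := svalP q.
split; first by apply: inj; rewrite ?pD ?qD ?pd ?qd (mv_add0, mv_addN0).
split=> [a|x y].
  by have [z [za _]] := ex a mv_zero; exists z.
split=> [xy|/(congr1 (sval p))]; last by rewrite !pD pd !mv_add0.
by apply: inj; rewrite ?pD ?qD ?xy // qd !mv_addN0.
Qed.

(** * Pushouts of quotients *)

Section Pushout.
Variables (P A C : pmvf_algebra) (d : P).
Variables (f : pmvf_hom P A) (g : pmvf_hom P C).
Hypotheses (dd : d ⊕ d = d) (fd : quotient_by d f).

(** A cocone over [f] and [g] is the same thing as a morphism out of [C] that
    kills [g d], since [f] is onto and its kernel is generated by [d]. *)
Lemma pushout_of_quotient (D : pmvf_algebra) (c : pmvf_hom C D) :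
  quotient_by (sval g d) c ->
  exists u : pmvf_hom A D, is_pushout (K := PMVf) f g u c.
Proof.
move=> cd; have [f_surj _] := fd; have [c_surj _] := cd.
have f0 := quotient_by_kill dd fd.
have c0 := quotient_by_kill (hom_idem g dd) cd.
have [u uf] := quotient_by_factor (k := pmvf_comp c g) fd c0.
exists u; split; first exact: pmvf_hom_eq.
move=> X a k akfg; have afE x : sval a (sval f x) = sval k (sval g x).
  exact: (pmvf_homE x akfg).
have k0 : sval k (sval g d) = mv_zero.
  by rewrite -afE f0; have [_ _ -> _] := svalP a.
have [h hc] := quotient_by_factor cd k0.
exists h; split.
  split; apply: pmvf_hom_eq => // y.
  by have [x <-] := f_surj y; rewrite /= uf /= hc afE.
move=> h' [_ h'c]; apply: pmvf_hom_eq => z.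
have [x <-] := c_surj z; rewrite hc.
by rewrite -(pmvf_homE x h'c).
Qed.

Lemma exists_pushout_of_quotient :
  exists (D : pmvf_algebra) (u : pmvf_hom A D) (c : pmvf_hom C D),
    is_pushout (K := PMVf) f g u c.
Proof.
have [D [c cd]] := exists_quotient_by (hom_idem g dd).
by have [u uc] := pushout_of_quotient cd; exists D, u, c.
Qed.

(** By uniqueness of pushouts, [c] agrees up to isomorphism with the quotient
    of [C] by [g d]. *)
Lemma pushout_quotient (D : pmvf_algebra)
    (u : pmvf_hom A D) (c : pmvf_hom C D) :
  is_pushout (K := PMVf) f g u c -> quotient_by (sval g d) c.
Proof.
move=> ucP; have [ufcg univ] := ucP.
have [D' [c' c'd]] := exists_quotient_by (hom_idem g dd).
have [c'_surj c'E] := c'd.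
have f0 := quotient_by_kill dd fd.
have cg0 : sval c (sval g d) = mv_zero.
  have /= <- := pmvf_homE d ufcg.
  by rewrite f0; have [_ _ -> _] := svalP u.
have [l lc'] := quotient_by_factor c'd cg0.
have [u' [u'fc'g _]] := pushout_of_quotient c'd.
have [k [[ku kc] _]] := univ D' u' c' u'fc'g.
have kcE x : sval k (sval c x) = sval c' x by apply: (pmvf_homE x kc).
have lk z : sval l (sval k z) = z.
  have [i [_ i_uniq]] := univ D u c ufcg.
  have i_id : i = pmvf_id D by apply: i_uniq; split; apply: pmvf_hom_eq.
  have i_lk : i = pmvf_comp l k.
    apply: i_uniq; split; apply: pmvf_hom_eq => x /=; last by rewrite kcE lc'.
    have [f_surj _] := fd; have [y <-] := f_surj x.
    have ufE : sval u (sval f y) = sval c (sval g y) by apply: (pmvf_homE y ufcg).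
    by rewrite ufE kcE lc'.
  by rewrite -[RHS]/(sval (pmvf_id D) z) -i_id i_lk.
split=> [z|x y].
  by have [x xz] := c'_surj (sval k z); exists x; rewrite -lc' xz lk.
split=> [xy|/c'E xy]; first by apply/c'E; rewrite -!kcE xy.
by rewrite -!lc' xy.
Qed.

End Pushout.

(** * Coextensivity *)

(** Injectivity of [h] says that the two kernels meet trivially; surjectivity
    is a Chinese remainder argument for [d] and [¬ d]. *)
Lemma quotient_decomposition (C C1 C2 Q : pmvf_algebra) (d : C)
    (c1 : pmvf_hom C C1) (c2 : pmvf_hom C C2)
    (q1 : pmvf_hom Q C1) (q2 : pmvf_hom Q C2) (h : pmvf_hom C Q) :
  d ⊕ d = d -> ¬ d ⊕ ¬ d = ¬ d ->
  quotient_by d c1 -> quotient_by (¬ d) c2 ->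
  is_product (K := PMVf) q1 q2 ->
  pmvf_comp q1 h = c1 -> pmvf_comp q2 h = c2 ->
  is_iso (K := PMVf) h.
Proof.
move=> dd nd [c1_surj c1E] [c2_surj c2E] /product_elements [_ q_inj] h1 h2.
have h1E x : sval q1 (sval h x) = sval c1 x by apply: (pmvf_homE x h1).
have h2E x : sval q2 (sval h x) = sval c2 x by apply: (pmvf_homE x h2).
apply: bijective_is_iso => [z|x y xy]; last first.
  apply: (mv_idem_inj nd); first by apply/c1E; rewrite -!h1E xy.
  by apply/c2E; rewrite -!h2E xy.
have [x xz] := c1_surj (sval q1 z); have [y yz] := c2_surj (sval q2 z).
exists ((x ⊖ d) ⊕ (y ⊖ ¬ d)); apply: q_inj.
  by rewrite h1E -xz; apply/c1E; apply: mv_idem_glue.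
rewrite h2E -yz; apply/c2E; rewrite (mv_addC (x ⊖ d)).
by have := mv_idem_glue y x nd; rewrite mv_negK.
Qed.

Theorem proposition7p1 : coextensive PMVf.
Proof.
split.
  split; first by exists unit_pmvf; apply: terminal_of_subsingleton; do 2!case.
  move=> A B; exists (prod_pmvf A B), (prod_fst A B), (prod_snd A B).
  exact: prod_is_product.
move=> A B P pA pB prodP.
have [pairP _] := product_elements prodP.
have [d [pAd pBd]] := pairP mv_zero (¬ mv_zero).
have [dd qA] := projection_quotient prodP pAd pBd.
have [nd qB] : ¬ d ⊕ ¬ d = ¬ d /\ quotient_by (¬ d) pB.
  apply: (projection_quotient (product_swap prodP)).
    by have [_ -> _ _] := svalP pB; rewrite pBd mv_negK.
  by have [_ -> _ _] := svalP pA; rewrite pAd.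
split=> [|C g].
  have [T [v vd]] := exists_quotient_by (hom_idem pB dd).
  have [u uv] := pushout_of_quotient dd qA vd.
  exists T, u, v; split=> //; apply: terminal_of_subsingleton => s t.
  have [v_surj vE] := vd; have [x <-] := v_surj s; have [y <-] := v_surj t.
  by apply/vE; rewrite pBd !mv_addN0.
split; first exact: exists_pushout_of_quotient dd qA.
split; first exact: exists_pushout_of_quotient nd qB.
move=> C1 C2 u1 c1 u2 c2 po1 po2 Q q1 q2 prodQ h h1 h2.
have gN : sval g (¬ d) = ¬ sval g d by have [_ -> _ _] := svalP g.
have c1d := pushout_quotient dd qA po1.
have c2d := pushout_quotient nd qB po2.
have gn := hom_idem g nd; rewrite gN in c2d gn.
exact: quotient_decomposition (hom_idem g dd) gn c1d c2d prodQ h1 h2.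
Qed.
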